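(* Any loxodromic element of $\mathrm{PU}(2,1)$ is a product of three holomorphic involutions of any kind: for every loxodromic $A\in\mathrm{PU}(2,1)$ and every triple of signs $(\varepsilon_1,\varepsilon_2,\varepsilon_3)\in\{-1,+1\}^3$, there exist involutions $I_1,I_2,I_3\in\mathrm{PU}(2,1)$ such that $A=I_1I_2I_3$ and, for each $k$, $I_k$ is a complex symmetry if $\varepsilon_k=+1$ and a central involution if $\varepsilon_k=-1$.
   Context: $\mathbb{C}^{2,1}$ is $\mathbb{C}^3$ with a Hermitian form of signature $(2,1)$; $\mathrm{PU}(2,1)$ is the projectivized unitary group, acting on the complex hyperbolic plane $\mathrm{H}^2_{\mathbb{C}}\subset\mathbb{CP}^2$ of negative lines, with boundary $\partial\mathrm{H}^2_{\mathbb{C}}$ the set of null lines. An element is loxodromic if it has no fixed point in $\mathrm{H}^2_{\mathbb{C}}$ and exactly two fixed points in $\partial\mathrm{H}^2_{\mathbb{C}}$. There are two conjugacy classes of involutions (order $2$ elements) in $\mathrm{PU}(2,1)$, those induced by the linear maps $Z\mapsto -Z+\varepsilon\langle Z,\mathbf{n}\rangle\mathbf{n}$ with $\langle\mathbf{n},\mathbf{n}\rangle=2\varepsilon$: central involutions ($\varepsilon=-1$, fixing an isolated point of $\mathrm{H}^2_{\mathbb{C}}$) and complex symmetries ($\varepsilon=+1$, fixing pointwise the complex line $\mathbf{n}^\perp$). *)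

(* Defs.v *)
From HB Require Import structures.
From mathcomp Require Import all_boot all_order all_algebra.
From mathcomp Require Import sesquilinear spectral complex reals.

Set Implicit Arguments.
Unset Strict Implicit.
Unset Printing Implicit Defensive.

Import Order.TTheory GRing.Theory Num.Theory.
Local Open Scope ring_scope.
Local Open Scope sesquilinear_scope.
Local Open Scope quotient_scope.

Section ComplexHyperbolicPlane.
Variables (R : realType) (H : 'M[R[i]]_3).
Local Notation C := R[i].

(* Vectors are columns and matrices act on the left, so that the product of   *)
(* matrices is the composition of maps.  The form is linear in [Z] and        *)
(* conjugate-linear in [W].                                                   *)
Definition hform (Z W : 'cV[C]_3) : C := (W^t* *m H *m Z) 0 0.

(* In the basis of C^3 given by the columns of [P], the Gram matrix of the    *)
(* form is diag(1, 1, -1).                                                    *)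
Definition signature21 : Prop :=
  exists2 P : 'M[C]_3, P \in unitmx &
    P^t* *m H *m P = diag_mx (\row_j (if j == ord_max then -1 else 1)).

(* Invertibility is required separately so that this is a group for every     *)
(* [H]; it is automatic when [H] is nondegenerate.                            *)
Definition is_unitary : pred 'M[C]_3 :=
  [pred A | (A \in unitmx) && (A^t* *m H *m A == H)].

Record U21 : Type := MkU21 { U21_mx : 'M[C]_3; _ : is_unitary U21_mx }.
HB.instance Definition _ := [isSub of U21 for U21_mx].
HB.instance Definition _ := [Choice of U21 by <:].

Lemma hform_unitary (A : 'M[C]_3) (Z W : 'cV[C]_3) :
  is_unitary A -> hform (A *m Z) (A *m W) = hform Z W.
Proof.
move=> /andP[_ /eqP AH].
by rewrite /hform trmx_mul map_mxM -!mulmxA (mulmxA H) (mulmxA (A^t*))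
  (mulmxA (A^t*)) AH.
Qed.

Fact U21_mul_subproof (A B : U21) : is_unitary (val A *m val B).
Proof.
case: A B => [A /andP[Au /eqP AH]] [B /andP[Bu /eqP BH]] /=.
rewrite /is_unitary /= unitmx_mul Au Bu /= trmx_mul map_mxM.
by rewrite -!mulmxA (mulmxA H) (mulmxA (A^t*)) (mulmxA (A^t*)) AH mulmxA BH.
Qed.

Fact U21_one_subproof : is_unitary 1%:M.
Proof. by rewrite /is_unitary /= unitmx1 trmx1 map_mx1 mul1mx mulmx1 eqxx. Qed.

Fact U21_inv_subproof (A : U21) : is_unitary (invmx (val A)).
Proof.
case: A => [A /andP[Au /eqP AH]] /=.
rewrite /is_unitary /= unitmx_inv Au /= -{1}AH -!mulmxA mulmxV // mulmx1 mulmxA.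
by rewrite -map_mxM -trmx_mul mulmxV // trmx1 map_mx1 mul1mx.
Qed.

Definition U21_mul (A B : U21) : U21 := Sub _ (U21_mul_subproof A B).
Definition U21_one : U21 := Sub _ U21_one_subproof.
Definition U21_inv (A : U21) : U21 := Sub _ (U21_inv_subproof A).

Fact U21_mulA : associative U21_mul.
Proof. by move=> A B D; apply: val_inj; rewrite /= mulmxA. Qed.
Fact U21_mul1 : left_id U21_one U21_mul.
Proof. by move=> A; apply: val_inj; rewrite /= mul1mx. Qed.
Fact U21_mulr1 : right_id U21_one U21_mul.
Proof. by move=> A; apply: val_inj; rewrite /= mulmx1. Qed.
Fact U21_unit (A : U21) : val A \in unitmx.
Proof. by case: A => A /= /andP[]. Qed.
Fact U21_mulV : left_inverse U21_one U21_inv U21_mul.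
Proof. by move=> A; apply: val_inj; rewrite /= mulVmx ?U21_unit. Qed.
Fact U21_mulrV : right_inverse U21_one U21_inv U21_mul.
Proof. by move=> A; apply: val_inj; rewrite /= mulmxV ?U21_unit. Qed.

HB.instance Definition _ :=
  isGroup.Build U21 U21_mulA U21_mul1 U21_mulr1 U21_mulV U21_mulrV.

Definition proj_eq : rel U21 :=
  fun A B => is_scalar_mx (invmx (val A) *m val B).

Lemma proj_eqP (A B : U21) :
  reflect (exists2 c : C, c != 0 & val B = c *: val A) (proj_eq A B).
Proof.
apply: (iffP is_scalar_mxP) => [[c AB]|[c _ ->]]; last first.
  by exists c; rewrite -scalemxAr mulVmx ?U21_unit // scalemx1.
have eB : val B = c *: val A.
  by rewrite -[val B](mulKVmx (U21_unit A)) AB mul_mx_scalar.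
exists c => //; apply/eqP => c0; have := U21_unit B.
by rewrite eB c0 scale0r unitmxE det0 unitr0.
Qed.

Fact proj_eq_refl : reflexive proj_eq.
Proof. by move=> A; apply/proj_eqP; exists 1; rewrite ?oner_eq0 ?scale1r. Qed.

Fact proj_eq_sym : symmetric proj_eq.
Proof.
suff sym A B : proj_eq A B -> proj_eq B A by move=> A B; apply/idP/idP => /sym.
move=> /proj_eqP[c c0 e]; apply/proj_eqP; exists c^-1; first by rewrite invr_eq0.
by rewrite e scalerA mulVf ?scale1r.
Qed.

Fact proj_eq_trans : transitive proj_eq.
Proof.
move=> B A D /proj_eqP[c c0 e] /proj_eqP[d d0 e']; apply/proj_eqP.
by exists (d * c); rewrite ?mulf_neq0 // e' e scalerA.
Qed.

Canonical proj_eq_equiv :=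
  EquivRel proj_eq proj_eq_refl proj_eq_sym proj_eq_trans.

Definition PU21 : Type := {eq_quot proj_eq}.
HB.instance Definition _ := Choice.on PU21.
HB.instance Definition _ := EqQuotient.on PU21.

Lemma piPU_eqP (A B : U21) :
  reflect (exists2 c : C, c != 0 & val B = c *: val A)
          (\pi_PU21 A == \pi_PU21 B).
Proof. by rewrite eqmodE; apply: proj_eqP. Qed.

Lemma reprPU (A : U21) :
  exists2 c : C, c != 0 & val A = c *: val (repr (\pi_PU21 A)).
Proof. by apply/piPU_eqP; rewrite reprK. Qed.

Definition PU21_one : PU21 := \pi_PU21 1%g.
Definition PU21_mul (A B : PU21) : PU21 := \pi_PU21 (repr A * repr B)%g.
Definition PU21_inv (A : PU21) : PU21 := \pi_PU21 (repr A)^-1%g.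

Lemma PU21_mul_pi (A B : U21) :
  PU21_mul (\pi_PU21 A) (\pi_PU21 B) = \pi_PU21 (A * B)%g.
Proof.
apply/eqP/piPU_eqP; have [c c0 eA] := reprPU A; have [d d0 eB] := reprPU B.
exists (c * d); first by rewrite mulf_neq0.
by rewrite /= eA eB -scalemxAl -scalemxAr scalerA.
Qed.

Lemma PU21_inv_pi (A : U21) : PU21_inv (\pi_PU21 A) = \pi_PU21 A^-1%g.
Proof.
apply/eqP/piPU_eqP; have [c c0 eA] := reprPU A.
exists c^-1; first by rewrite invr_eq0.
by rewrite /= eA invmxZ // unitmxZ ?unitfE // U21_unit.
Qed.

Fact PU21_mulA : associative PU21_mul.
Proof.
elim/quotW=> A; elim/quotW=> B; elim/quotW=> D.
rewrite (PU21_mul_pi B D) (PU21_mul_pi A B).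
by rewrite (PU21_mul_pi A (B * D)%g) (PU21_mul_pi (A * B)%g D) mulgA.
Qed.
Fact PU21_mul1 : left_id PU21_one PU21_mul.
Proof. by elim/quotW=> A; rewrite (PU21_mul_pi 1%g A) mul1g. Qed.
Fact PU21_mulr1 : right_id PU21_one PU21_mul.
Proof. by elim/quotW=> A; rewrite (PU21_mul_pi A 1%g) mulg1. Qed.
Fact PU21_mulV : left_inverse PU21_one PU21_inv PU21_mul.
Proof.
by elim/quotW=> A; rewrite PU21_inv_pi (PU21_mul_pi A^-1%g A) mulVg.
Qed.
Fact PU21_mulrV : right_inverse PU21_one PU21_inv PU21_mul.
Proof.
by elim/quotW=> A; rewrite PU21_inv_pi (PU21_mul_pi A A^-1%g) mulgV.
Qed.

HB.instance Definition _ :=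
  isGroup.Build PU21 PU21_mulA PU21_mul1 PU21_mulr1 PU21_mulV PU21_mulrV.

(* A point of CP^2 is a 1-dimensional subspace of C^3.                        *)
Definition in_H2C (L : {vspace 'cV[C]_3}) : Prop :=
  \dim L = 1%N /\ forall Z, Z \in L -> Z != 0 -> hform Z Z < 0.

Definition in_boundary_H2C (L : {vspace 'cV[C]_3}) : Prop :=
  \dim L = 1%N /\ forall Z, Z \in L -> hform Z Z = 0.

Definition U21_act (A : U21) (L : {vspace 'cV[C]_3}) : {vspace 'cV[C]_3} :=
  (linfun (mulmx (val A)) @: L)%VS.

Definition PU21_act (A : PU21) (L : {vspace 'cV[C]_3}) : {vspace 'cV[C]_3} :=
  U21_act (repr A) L.

Lemma PU21_act_pi (A : U21) (L : {vspace 'cV[C]_3}) :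
  PU21_act (\pi_PU21 A) L = U21_act A L.
Proof.
have [c c0 eA] := reprPU A; rewrite /PU21_act /U21_act eA.
apply/vspaceP => Z; apply/memv_imgP/memv_imgP => -[W WL ->].
- exists (c^-1 *: W); first by rewrite memvZ.
  by rewrite !lfunE /= -scalemxAl -scalemxAr scalerA mulfV ?scale1r.
- exists (c *: W); first by rewrite memvZ.
  by rewrite !lfunE /= -scalemxAl -scalemxAr.
Qed.

Definition loxodromic (A : PU21) : Prop :=
  (forall L, in_H2C L -> PU21_act A L <> L) /\
  exists L1 L2, L1 <> L2 /\
    forall L, (in_boundary_H2C L /\ PU21_act A L = L) <-> (L = L1 \/ L = L2).

Definition induced_by (A : PU21) (f : 'cV[C]_3 -> 'cV[C]_3) : Prop :=
  exists2 B : U21, A = \pi_PU21 B & forall Z, val B *m Z = f Z.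

Definition involution (I : PU21) : Prop := I <> 1%g /\ (I * I)%g = 1%g.

Definition complex_symmetry (I : PU21) : Prop :=
  exists2 n : 'cV[C]_3, hform n n = 2 &
    induced_by I (fun Z => - Z + hform Z n *: n).

Definition central_involution (I : PU21) : Prop :=
  exists2 n : 'cV[C]_3, hform n n = - 2 &
    induced_by I (fun Z => - Z - hform Z n *: n).

End ComplexHyperbolicPlane.

(* Main.v *)
Require Import Defs.
From mathcomp Require Import all_boot all_order all_algebra.
From mathcomp Require Import sesquilinear spectral complex reals.
From mathcomp Require Import ring lra.

Set Implicit Arguments.
Unset Strict Implicit.
Unset Printing Implicit Defensive.

Import Order.TTheory GRing.Theory Num.Theory.
Local Open Scope ring_scope.
Local Open Scope sesquilinear_scope.
Local Open Scope quotient_scope.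

(** Why the theorem is true.

    Write I(e, n) for the reflection Z |-> -Z + e <Z,n> n with <n,n> = 2e,
    e = 1 or -1.  It is unitary, of determinant 1 and of square 1.  So it is
    enough to find a lift g of A and a vector n3 of type e3 such that
    B = g I(e3, n3) is a product I(e1, n1) I(e2, n2): then
    g = I(e1, n1) I(e2, n2) I(e3, n3).

    When is B in SU(2,1) such a product?  The characteristic polynomial of B is
    X^3 - T X^2 + T^* X - 1 with T the trace of B ([SU21_char_poly]).  If T is
    real, it factors as (X - 1)(X^2 - (T - 1) X + 1), and if moreover
    e1 e2 T >= 4, its roots are 1, rho, 1/rho with rho real of sign e1 e2 and
    rho <> 1, -1.  The eigenvectors u1, u2 of rho and 1/rho are then null, can
    be normalized by <u1,u2> = 1, and are orthogonal to the fixed vector of B.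
    A reflection of the plane spanned by u1 and u2 exchanges the two null
    lines, and two of them, of types e1 and e2, compose to
    diag(e1 e2 t^2, e1 e2 t^-2) for any prescribed real t <> 0.  Taking
    t^2 = e1 e2 rho gives B ([two_reflections_of_trace]).

    It remains to choose g and n3 so that tr B is real and e1 e2 tr B >= 4
    ([loxodromic_times_reflection]).  A loxodromic A has a lift of determinant 1
    with eigenvalues w r, w / r, w^-2, where r > 0, r <> 1 and |w| = 1, the
    first two on null vectors V1, V2 with <V1,V2> = 1 and the third on a unit
    vector V3 orthogonal to them ([loxodromic_eigenbasis]).  Only w^3 is
    determined by A, and among the three cube roots of a complex number some
    have positive and some have negative real part, so the sign of Re w is free
    ([loxodromic_lift]).  For n3 = x V1 + V2 + y V3 with
    |y|^2 = 2 e3 - 2 Re x, the trace of B is an affine function of Re x and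
    Im x.  As r <> 1, Im x moves it along the line i w R, which is not real
    since Re w <> 0; hence every value of Re x admits an Im x making the trace
    real.  The resulting real trace is an affine function of Re x, and Re x
    ranges over the half-line below e3: the trace goes to infinity with a sign
    that is governed by e3 and by the sign of Re w, and the latter can be
    chosen ([trace_parameter]). *)

(** * Signs *)

Definition is_sign (K : nzRingType) (e : K) := e = 1 \/ e = -1.

Lemma is_sign_sqr (K : nzRingType) (e : K) : is_sign e -> e * e = 1.
Proof. by case=> ->; rewrite ?mulrNN mulr1. Qed.

Lemma is_signM (K : nzRingType) (e e' : K) :
  is_sign e -> is_sign e' -> is_sign (e * e').
Proof.
by move=> [] -> [] ->; rewrite ?mulrNN ?mul1r ?mulr1; [left|right|right|left].
Qed.

Lemma is_sign_conj (K : numClosedFieldType) (e : K) : is_sign e -> e^* = e.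
Proof. by case=> ->; rewrite ?rmorphN rmorph1. Qed.

Lemma is_sign_intr (K : nzRingType) (k : int) :
  k = -1 \/ k = 1 -> is_sign (k%:~R : K).
Proof. by case=> ->; [right; rewrite mulrN1z | left]. Qed.

(** * Matrices of size 3 *)

Section LinearAlgebra.
Variable F : fieldType.
Implicit Types (u v w x : 'cV[F]_3) (M N : 'M[F]_3).

Definition cols3 u v w : 'M[F]_3 :=
  \matrix_(i, j) [:: u i 0; v i 0; w i 0]`_j.

Definition col3 (a b c : F) : 'cV[F]_3 := \col_i [:: a; b; c]`_i.

Lemma mul_cols3 M u v w : M *m cols3 u v w = cols3 (M *m u) (M *m v) (M *m w).
Proof.
apply/matrixP => i [[|[|[|//]]] lt_j3]; rewrite !mxE /=;
  by apply: eq_bigr => k _; rewrite mxE.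
Qed.

Lemma cols3_col3 u v w a b c :
  cols3 u v w *m col3 a b c = a *: u + b *: v + c *: w.
Proof.
apply/matrixP => i j; rewrite !mxE !big_ord_recl big_ord0 !mxE /= addr0 addrA.
by rewrite (ord1 j); ring.
Qed.

Lemma col3_surj x : exists a b c, x = col3 a b c.
Proof.
exists (x 0 0), (x 1 0), (x 2%:R 0); apply/matrixP => i j; rewrite (ord1 j) mxE.
by case: i => [[|[|[|//]]] lt_i3] /=; congr (x _ _); apply: val_inj.
Qed.

Lemma ker0_unitmx n (M : 'M[F]_n) :
  (forall x : 'cV_n, M *m x = 0 -> x = 0) -> M \in unitmx.
Proof.
move=> M0; rewrite unitmxE unitfE -det_tr; apply/negP => /det0P[k k0 kM].
case/eqP: k0; rewrite -[k]trmxK (M0 k^T) ?trmx0 //.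
by rewrite -[M]trmxK -trmx_mul kM trmx0.
Qed.

Lemma det0_ker n (M : 'M[F]_n) :
  \det M = 0 -> exists2 x : 'cV_n, x != 0 & M *m x = 0.
Proof.
move=> M0; have /det0P[k k0 kM] : \det M^T == 0 by rewrite det_tr M0.
exists k^T; first by rewrite -trmx0 (inj_eq (can_inj (@trmxK _ _ _))).
by rewrite -[M]trmxK -trmx_mul kM trmx0.
Qed.

Lemma cols3_unit u v w :
  (forall a b c, a *: u + b *: v + c *: w = 0 -> [/\ a = 0, b = 0 & c = 0]) ->
  cols3 u v w \in unitmx.
Proof.
move=> uvw; apply: ker0_unitmx => x; have [a [b [c ->]]] := col3_surj x.
rewrite cols3_col3 => /uvw[-> -> ->].
by apply/matrixP => i j; rewrite !mxE; case: i => [[|[|[|]]]].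
Qed.

Lemma cols3_span u v w x : cols3 u v w \in unitmx ->
  exists a b c, x = a *: u + b *: v + c *: w.
Proof.
move=> U; have [a [b [c e]]] := col3_surj (invmx (cols3 u v w) *m x).
by exists a, b, c; rewrite -cols3_col3 -e mulKVmx.
Qed.

Lemma eq_on_basis u v w M N : cols3 u v w \in unitmx ->
  M *m u = N *m u -> M *m v = N *m v -> M *m w = N *m w -> M = N.
Proof.
move=> U Mu Mv Mw; rewrite -[M](mulmxK U) -[N](mulmxK U).
by rewrite !mul_cols3 Mu Mv Mw.
Qed.

Lemma det_mx33 M : \det M =
  M 0 0 * (M 1 1 * M 2%:R 2%:R - M 1 2%:R * M 2%:R 1)
  - M 0 1 * (M 1 0 * M 2%:R 2%:R - M 1 2%:R * M 2%:R 0)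
  + M 0 2%:R * (M 1 0 * M 2%:R 1 - M 1 1 * M 2%:R 0).
Proof.
rewrite (expand_det_row _ 0) !big_ord_recl big_ord0 /cofactor.
rewrite !(expand_det_row _ ord0) !big_ord_recl !big_ord0 /cofactor.
rewrite !det_mx11 !mxE /=.
(* Reading the entries off a function of natural numbers makes the bounds of
   the nested minors computable. *)
pose m k l := M (inord k) (inord l); have eM i j : M i j = m i j.
  by rewrite /m !inord_val.
by clearbody m; rewrite !eM /= /bump /=; ring.
Qed.

Lemma eigenbasis_tr_det u v w M (a b c : F) : cols3 u v w \in unitmx ->
  M *m u = a *: u -> M *m v = b *: v -> M *m w = c *: w ->
  \tr M = a + b + c /\ \det M = a * b * c.
Proof.
move=> U Mu Mv Mw.
pose D := cols3 (col3 a 0 0) (col3 0 b 0) (col3 0 0 c).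
have MP : M *m cols3 u v w = cols3 u v w *m D.
  by rewrite !mul_cols3 !cols3_col3 Mu Mv Mw !scale0r !(add0r, addr0).
have -> : M = cols3 u v w *m D *m invmx (cols3 u v w) by rewrite -MP mulmxK.
rewrite mxtrace_mulC mulmxA mulVmx // mul1mx !det_mulmx det_inv mulrAC.
rewrite mulfV ?mul1r; last by rewrite -unitfE -unitmxE.
split; first by rewrite /mxtrace !big_ord_recl big_ord0 !mxE /= addr0 addrA.
by rewrite det_mx33 !mxE /=; ring.
Qed.

(** The case of size 3 of det(1 - u v) = 1 - v u, up to sign. *)
Lemma det_rank1_sub1 u (v : 'rV[F]_3) :
  \det (- 1%:M + u *m v) = (v *m u) 0 0 - 1.
Proof.
rewrite -[v]trmxK; have [a [b [c ->]]] := col3_surj v^T.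
have [x [y [z ->]]] := col3_surj u.
by rewrite det_mx33 !mxE !big_ord_recl !big_ord0 !mxE /=; ring.
Qed.

Lemma det_scalar_sub33 M : exists m, forall x : F,
  \det (x%:M - M) = x ^+ 3 - \tr M * x ^+ 2 + m * x - \det M.
Proof.
exists (M 0 0 * M 1 1 - M 0 1 * M 1 0
  + (M 0 0 * M 2%:R 2%:R - M 0 2%:R * M 2%:R 0)
  + (M 1 1 * M 2%:R 2%:R - M 1 2%:R * M 2%:R 1)) => x.
have -> : \tr M = M 0 0 + M 1 1 + M 2%:R 2%:R.
  rewrite /mxtrace !big_ord_recl big_ord0 addr0 addrA.
  by congr (_ + M _ _ + M _ _); apply: val_inj.
by rewrite !det_mx33 !mxE /= ?mulr0n ?mulr1n; ring.
Qed.

Lemma eigenvectors_unit M u v w (a b c : F) :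
  M *m u = a *: u -> M *m v = b *: v -> M *m w = c *: w ->
  u != 0 -> v != 0 -> w != 0 -> a != b -> b != c -> c != a ->
  cols3 u v w \in unitmx.
Proof.
move=> Mu Mv Mw u0 v0 w0 ab bc ca; apply: cols3_unit => x y z E0.
have E1 : (x * a) *: u + (y * b) *: v + (z * c) *: w = 0.
  move: (congr1 (mulmx M) E0).
  by rewrite mulmx0 !mulmxDr -!scalemxAr Mu Mv Mw !scalerA.
have E2 : (x * a * a) *: u + (y * b * b) *: v + (z * c * c) *: w = 0.
  move: (congr1 (mulmx M) E1).
  by rewrite mulmx0 !mulmxDr -!scalemxAr Mu Mv Mw !scalerA.
have coef0 k d q : d != 0 -> q != 0 -> (k * d) *: q = 0 :> 'cV[F]_3 -> k = 0.
  move=> /negPf d0 /negPf q0 /eqP.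
  by rewrite scaler_eq0 q0 orbF mulf_eq0 d0 orbF => /eqP.
(* (M - p)(M - q) applied to the relation: taking for p and q two of the
   eigenvalues leaves only the third term. *)
pose comb p q : 'cV[F]_3 :=
  (x * a * a) *: u + (y * b * b) *: v + (z * c * c) *: w
  - (p + q) *: ((x * a) *: u + (y * b) *: v + (z * c) *: w)
  + (p * q) *: (x *: u + y *: v + z *: w).
have comb0 p q : comb p q = 0.
  by rewrite /comb E0 E1 E2 !scaler0 subr0 addr0.
split.
- apply: (coef0 x ((a - b) * (a - c)) u) => //.
    by rewrite mulf_neq0 // subr_eq0 // eq_sym.
  by rewrite -(comb0 b c) /comb; apply/matrixP => i j; rewrite !mxE; ring.
- apply: (coef0 y ((b - c) * (b - a)) v) => //.
    by rewrite mulf_neq0 // subr_eq0 // eq_sym.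
  by rewrite -(comb0 c a) /comb; apply/matrixP => i j; rewrite !mxE; ring.
- apply: (coef0 z ((c - a) * (c - b)) w) => //.
    by rewrite mulf_neq0 // subr_eq0 // eq_sym.
  by rewrite -(comb0 a b) /comb; apply/matrixP => i j; rewrite !mxE; ring.
Qed.

End LinearAlgebra.

(** * The Hermitian form and its reflections *)

Section HermitianForm.
Variables (R : realType) (H : 'M[R[i]]_3).
Local Notation C := R[i].
Local Notation h := (hform H).
Implicit Types (Z W n : 'cV[C]_3) (a b c e : C) (M : 'M[C]_3).

Lemma hformDl Z Z' W : h (Z + Z') W = h Z W + h Z' W.
Proof. by rewrite /hform mulmxDr mxE. Qed.

Lemma hformZl a Z W : h (a *: Z) W = a * h Z W.
Proof. by rewrite /hform -scalemxAr mxE. Qed.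

Lemma hformNl Z W : h (- Z) W = - h Z W.
Proof. by rewrite -scaleN1r hformZl mulN1r. Qed.

Lemma hformDr Z W W' : h Z (W + W') = h Z W + h Z W'.
Proof. by rewrite /hform linearD /= map_mxD !mulmxDl mxE. Qed.

Lemma hformZr a Z W : h Z (a *: W) = a^* * h Z W.
Proof. by rewrite /hform linearZ /= map_mxZ -!scalemxAl mxE. Qed.

Lemma hformNr Z W : h Z (- W) = - h Z W.
Proof. by rewrite -scaleN1r hformZr rmorphN rmorph1 mulN1r. Qed.

Definition hformE := (hformDl, hformDr, hformNl, hformNr, hformZl, hformZr).

Lemma hform0r Z : h Z 0 = 0.
Proof. by rewrite -(scale0r (0 : 'cV[C]_3)) hformZr conjC0 mul0r. Qed.

(** Turns a form value met inside a product of matrices into a scalar. *)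
Lemma hform_row Z W : W^t* *m H *m Z = (h Z W)%:M.
Proof. by rewrite [LHS]mx11_scalar. Qed.

Hypothesis H_herm : H \is hermsymmx.

Lemma herm_adj : H^t* = H.
Proof. by rewrite {2}(is_hermitianmxP _ _ _ H_herm) expr0 scale1r. Qed.

Lemma hformC Z W : h Z W = (h W Z)^*.
Proof.
have -> : (h W Z)^* = ((Z^t* *m H *m W)^t*) 0 0 by rewrite [RHS]mxE mxE.
by rewrite !trmx_mul !map_mxM herm_adj trmxCK mulmxA.
Qed.

Lemma hform_real Z : h Z Z \is Num.real.
Proof. by rewrite CrealE; apply/eqP; rewrite -hformC. Qed.

(** The involution induced by n as a matrix, with e = 1 for a complex symmetry
    and e = -1 for a central involution, when <n,n> = 2e. *)
Definition refl e n : 'M[C]_3 := - 1%:M + (e *: n) *m (n^t* *m H).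

Lemma refl_mul e n Z : refl e n *m Z = - Z + (e * h Z n) *: n.
Proof.
rewrite /refl mulmxDl mulNmx mul1mx -!mulmxA -scalemxAl (mulmxA _ H) hform_row.
by rewrite mul_mx_scalar scalerA.
Qed.

Section Involution.
Variables (e : C) (n : 'cV[C]_3).
Hypotheses (e_sign : is_sign e) (n_norm : h n n = e * 2%:R).

Lemma refl_refl : refl e n *m refl e n = 1%:M.
Proof.
have en : refl e n *m (e *: n) = e *: n.
  rewrite refl_mul hformZl n_norm -scaleNr -scalerDl; congr (_ *: _).
  by rewrite [e * (e * _)]mulrA is_sign_sqr //; ring.
by rewrite {2}/refl mulmxDr mulmxN mulmx1 mulmxA en /refl opprD opprK subrK.
Qed.

Lemma refl_det : \det (refl e n) = 1.
Proof.
rewrite /refl det_rank1_sub1 -scalemxAr hform_row n_norm !mxE /= mulr1n mulrA.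
by rewrite is_sign_sqr // mul1r; ring.
Qed.

(** [refl e n] is self-adjoint for the form, so its being an involution is the
    same as its being unitary. *)
Lemma refl_unitary : Defs.is_unitary H (refl e n).
Proof.
have [U _] := mulmx1_unit refl_refl; rewrite /Defs.is_unitary /= U /=.
have -> : (refl e n)^t* *m H = H *m refl e n.
  rewrite /refl linearD /= linearN /= trmx1 map_mxD map_mxN map_mx1.
  rewrite !trmx_mul !map_mxM trmxCK linearZ /= map_mxZ herm_adj.
  rewrite [X in X *: _](is_sign_conj e_sign).
  rewrite mulmxDl mulmxDr mulNmx mulmxN mul1mx mulmx1.
  by rewrite -!(scalemxAr, scalemxAl) !mulmxA.
by rewrite -mulmxA refl_refl mulmx1.
Qed.

Definition U21_refl : U21 H := MkU21 refl_unitary.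

(** Through the term in n, the choice of n prescribes the trace of a product
    with a reflection. *)
Lemma refl_trace M : \tr (M *m refl e n) = - \tr M + e * h (M *m n) n.
Proof.
rewrite /refl mulmxDr mulmxN mulmx1 linearD linearN /=.
rewrite -scalemxAl -scalemxAr linearZ /= mulmxA mxtrace_mulC.
by rewrite hform_row mxtrace_scalar.
Qed.

(** Projectively nontrivial: a scalar matrix fixing n would be 1, whose trace
    is 3, while a reflection has trace -1. *)
Lemma refl_involution : involution (\pi_(PU21 H) U21_refl).
Proof.
split; last first.
  rewrite [LHS]PU21_mul_pi; congr (\pi_(PU21 H) _); apply: val_inj => /=.
  exact: refl_refl.
rewrite /1%g /= /PU21_one => /eqP; rewrite eq_sym => /piPU_eqP[c _ /= eS].
have tr_refl : \tr (refl e n) = -1.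
  rewrite -[refl e n]mul1mx refl_trace mxtrace1 mul1mx n_norm mulrA.
  by rewrite is_sign_sqr // mul1r; ring.
have := refl_mul e n n; rewrite eS -scalemxAl mul1mx n_norm mulrA.
rewrite is_sign_sqr // mul1r => cn.
have /eqP : (c - 1) *: n = 0.
  by rewrite scalerBl cn; apply/matrixP => i j; rewrite !mxE; ring.
rewrite scaler_eq0 subr_eq0 => /orP[/eqP c1|/eqP n0].
  move: tr_refl; rewrite eS c1 scale1r mxtrace1 => /eqP.
  by rewrite -subr_eq0 opprK natr1 pnatr_eq0.
case/eqP: (oner_neq0 C); rewrite -(is_sign_sqr e_sign).
move: n_norm; rewrite n0 hform0r => /esym/eqP; rewrite mulf_eq0 pnatr_eq0 orbF.
by move=> /eqP ->; rewrite mul0r.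
Qed.

End Involution.

End HermitianForm.

(** * The signature, and products of two reflections *)

Section Signature.
Variables (R : realType) (H : 'M[R[i]]_3).
Local Notation C := R[i].
Local Notation h := (hform H).
Implicit Types (Z W n : 'cV[C]_3) (a b c e : C) (M : 'M[C]_3).
Hypotheses (H_herm : H \is hermsymmx) (H_sign : signature21 H).

(** What the single minus sign of the signature gives: the third coordinate in a
    diagonal basis vanishes at no nonzero vector of nonpositive norm. *)
Lemma signature_functional : exists f : 'rV[C]_3,
  forall Z, (f *m Z) 0 0 = 0 -> h Z Z <= 0 -> Z = 0.
Proof.
have [P U PHP] := H_sign; exists (row ord_max (invmx P)) => Z.
have [x [y [z zE]]] := col3_surj (invmx P *m Z).
have -> : Z = P *m col3 x y z by rewrite -zE mulKVmx.
rewrite -row_mul mulKmx // !mxE /= => ->.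
have -> : h (P *m col3 x y 0) (P *m col3 x y 0) = `|x| ^+ 2 + `|y| ^+ 2.
  set k := col3 x y 0.
  have -> : h (P *m k) (P *m k) = (k^t* *m (P^t* *m H *m P) *m k) 0 0.
    by rewrite /hform trmx_mul map_mxM !mulmxA.
  rewrite PHP mul_mx_diag !mxE !big_ord_recl big_ord0 !mxE /= !normCK.
  by rewrite !mulr1 !mulr0 !addr0 ![_^* * _]mulrC.
rewrite le_eqVlt le_gtF ?addr_ge0 ?exprn_ge0 // orbF.
rewrite paddr_eq0 ?exprn_ge0 // !expf_eq0 /= !normr_eq0 => /andP[/eqP-> /eqP->].
rewrite (_ : col3 0 0 0 = 0) ?mulmx0 //; apply/matrixP => i j; rewrite !mxE.
by case: i => [[|[|[|//]]]].
Qed.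

(** A subspace on which the form is nonpositive has dimension at most 1:
    otherwise some nonzero vector of it would be killed by the functional of
    [signature_functional].  So distinct null lines are not orthogonal, and
    the orthogonal complement of a negative vector is positive. *)
Lemma orthogonal_nonpositive Z W :
  h Z Z <= 0 -> h W W <= 0 -> h Z W = 0 -> Z != 0 -> exists a, W = a *: Z.
Proof.
have [f f0] := signature_functional; move=> ZZ WW ZW Z0.
have fZ : (f *m Z) 0 0 != 0 by apply: contra_neq Z0 => /f0; apply.
pose a := (f *m W) 0 0 / (f *m Z) 0 0; exists a.
apply/eqP; rewrite -subr_eq0; apply/eqP/f0.
  have fM (x y : C) : x = (f *m W) 0 0 -> y = (f *m Z) 0 0 -> x - a * y = 0.
    by move=> -> ->; rewrite divfK ?subrr.
  by rewrite mulmxBr -scalemxAr !mxE; apply: fM; rewrite mxE.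
have -> : h (W - a *: Z) (W - a *: Z) = h W W + `|a| ^+ 2 * h Z Z.
  by rewrite !hformE (hformC H_herm W Z) ZW conjC0 normCK; ring.
by rewrite -oppr_ge0 opprD addr_ge0 ?oppr_ge0 // mulr_ge0_le0 ?exprn_ge0.
Qed.

Lemma form_unitmx : H \in unitmx.
Proof.
have [P U PHP] := H_sign.
have : P^t* *m H *m P \in unitmx.
  rewrite PHP unitmxE det_diag unitfE; apply/prodf_neq0 => i _; rewrite mxE.
  by case: ifP; rewrite ?oppr_eq0 oner_neq0.
by rewrite !unitmx_mul => /andP[/andP[]].
Qed.

Lemma form_nondegenerate Z : (forall W, h Z W = 0) -> Z = 0.
Proof.
move=> Z0; rewrite -[Z](mulKmx form_unitmx) (_ : H *m Z = 0) ?mulmx0 //.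
apply/matrixP => i j; have := Z0 (delta_mx i 0).
by rewrite /hform trmx_delta map_delta_mx -mulmxA -rowE !mxE (ord1 j).
Qed.

Section Unitary.
Variable B : 'M[C]_3.
Hypothesis B_unitary : Defs.is_unitary H B.

Lemma eigenvectors_orthogonal Z W a b : B *m Z = a *: Z -> B *m W = b *: W ->
  a * b^* != 1 -> h Z W = 0.
Proof.
move=> BZ BW ab; have := hform_unitary Z W B_unitary.
rewrite BZ BW hformZl hformZr mulrA => /eqP.
rewrite -subr_eq0 -[X in _ - X]mul1r.
by rewrite -mulrBl mulf_eq0 subr_eq0 (negPf ab) => /eqP.
Qed.

Hypothesis B_det : \det B = 1.

(** The determinant form of the characteristic polynomial chi leaves open the
    coefficient m of degree 1.  For s = 1 and s = -1, unitarity gives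
    (s - B)^* H B = - s H (s - B), hence chi(s)^* = - s chi(s), and the two
    equations together give m = (tr B)^*. *)
Lemma SU21_char_poly a :
  \det (a%:M - B) = a ^+ 3 - \tr B * a ^+ 2 + (\tr B)^* * a - 1.
Proof.
have /andP[_ /eqP BH] := B_unitary.
have [m chi] := det_scalar_sub33 B; rewrite B_det in chi.
have detH : \det H != 0 by rewrite -unitfE -unitmxE form_unitmx.
have chi_conj s : is_sign s -> (\det (s%:M - B))^* = - s * \det (s%:M - B).
  move=> s_sign; apply: (mulIf detH).
  have adj_eq : (s%:M - B)^t* *m H *m B = - s *: (H *m (s%:M - B)).
    rewrite linearB /= tr_scalar_mx map_mxB map_scalar_mx /= is_sign_conj //.
    rewrite !mulmxBl BH mul_scalar_mx mulmxBr mul_mx_scalar -scalemxAl scalerBr.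
    by rewrite scalerA mulNr is_sign_sqr // !scaleNr scale1r opprK addrC.
  have := congr1 determinant adj_eq; rewrite !det_mulmx B_det mulr1.
  rewrite det_map_mx det_tr => ->; rewrite detZ det_mulmx exprS expr2 mulrNN.
  by rewrite is_sign_sqr //; ring.
have two : 2%:R != 0 :> C by rewrite pnatr_eq0.
have c1 := chi_conj 1 (or_introl erefl).
have c2 := chi_conj (-1) (or_intror erefl).
rewrite !chi in c1 c2 *; suff -> : m = (\tr B)^* by [].
move: c1 c2.
rewrite !(rmorphB, rmorphD, rmorphM, rmorphXn, rmorphN, rmorph1) /=.
move=> /eqP; rewrite -subr_eq0 => /eqP c1 /eqP; rewrite -subr_eq0 => /eqP c2.
apply/eqP; rewrite -subr_eq0 -(mulrI_eq0 _ (mulfI two)).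
by apply/eqP; rewrite -[RHS]addr0 -{1}c1 -c2; ring.
Qed.

End Unitary.

(** As k + 2 and k - 2 are the squares of t + 1/t and t - 1/t, t is half the sum
    of their square roots. *)
Lemma hyperbolic_parameter (k : C) : 3%:R <= k ->
  exists t, [/\ t != 0, t^* = t & t ^+ 2 + t^-1 ^+ 2 = k].
Proof.
move=> k3; pose p := sqrtC (k + 2%:R); pose q := sqrtC (k - 2%:R).
have k2 : 0 <= k - 2%:R by rewrite subr_ge0 (le_trans _ k3) // ler_nat.
have k2' : 0 <= k + 2%:R by rewrite addr_ge0 // (le_trans _ k3) // ler0n.
have pR : p^* = p by apply: geC0_conj; rewrite sqrtC_ge0.
have qR : q^* = q by apply: geC0_conj; rewrite sqrtC_ge0.
have p2 : p ^+ 2 = k + 2%:R by rewrite sqrtCK.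
have q2 : q ^+ 2 = k - 2%:R by rewrite sqrtCK.
have two : 2%:R != 0 :> C by rewrite pnatr_eq0.
have tV : (p + q) / 2%:R * ((p - q) / 2%:R) = 1.
  transitivity ((p ^+ 2 - q ^+ 2) / 4%:R); first by field.
  by rewrite p2 q2; field.
have t0 : (p + q) / 2%:R != 0.
  by apply: contra_eq_neq tV => ->; rewrite mul0r eq_sym oner_neq0.
exists ((p + q) / 2%:R); split => //.
  by rewrite rmorphM rmorphD /= pR qR fmorphV rmorph_nat.
have -> : ((p + q) / 2%:R)^-1 = (p - q) / 2%:R.
  by rewrite -[RHS](mulKf t0) tV mulr1.
transitivity ((p ^+ 2 + q ^+ 2) / 2%:R); first by field.
by rewrite p2 q2; field.
Qed.

(** The hypothesis makes the trace real, because the order of the complex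
    numbers only compares numbers with equal imaginary parts.  The eigenvalues
    of B are then 1, r, r' with r and r' real, r r' = 1 and r <> r'.  The
    eigenvectors u1 and u2 of r and r' are null, and the two reflections are
    taken in the plane that they span. *)
Lemma two_reflections_of_trace (B : 'M[C]_3) (e1 e2 : C) :
  is_sign e1 -> is_sign e2 -> Defs.is_unitary H B -> \det B = 1 ->
  4%:R <= e1 * e2 * \tr B ->
  exists n1 n2, [/\ h n1 n1 = e1 * 2%:R, h n2 n2 = e2 * 2%:R
                  & B = refl H e1 n1 *m refl H e2 n2].
Proof.
move=> s1 s2 BU B1 trB; pose e := e1 * e2.
have es : is_sign e by exact: is_signM.
have ee := is_sign_sqr es.
pose k := e * (\tr B - 1).
have k3 : 3%:R <= k.
  rewrite /k mulrBr mulr1 lerBrDr (le_trans _ trB) //.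
  by case: es => ->; rewrite ?natr1 // lerBlDr natr1 ler_nat.
have [t [t0 tR tk]] := hyperbolic_parameter k3.
pose r := e * t ^+ 2; pose r' := e * t^-1 ^+ 2.
have rr' : r * r' = 1.
  by rewrite /r /r' mulrACA ee mul1r -exprMn mulfV // expr1n.
have rC : r^* = r by rewrite rmorphM rmorphXn /= tR is_sign_conj.
have r'C : r'^* = r' by rewrite rmorphM rmorphXn /= fmorphV /= tR is_sign_conj.
have rDr' : r + r' = \tr B - 1.
  by rewrite /r /r' -mulrDr tk /k mulrA ee mul1r.
have trR : (\tr B)^* = \tr B.
  have -> : \tr B = r + r' + 1 by rewrite rDr' subrK.
  by rewrite !rmorphD rmorph1 /= rC r'C.
have r_neq s : is_sign s -> r != s.
  move=> ss; apply/eqP => rs; have r's : r' = s.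
    by rewrite -[r']mul1r -(is_sign_sqr ss) -mulrA -{2}rs rr' mulr1.
  move: k3; rewrite /k -rDr' rs r's; apply/negP; rewrite lt_geF //.
  rewrite (_ : s + s = s * 2%:R); last by ring.
  rewrite mulrA; case: (is_signM es ss) => ->; first by rewrite mul1r ltr_nat.
  by rewrite mulN1r (@lt_trans _ _ 0) // ?oppr_lt0 ltr0n.
have eigen x : (x - 1) * ((x - r) * (x - r')) = 0 ->
    exists2 u : 'cV[C]_3, u != 0 & B *m u = x *: u.
  move=> x0; have [|u u0 Bu] := @det0_ker _ _ (x%:M - B).
    rewrite (SU21_char_poly BU B1) trR -x0.
    have -> : \tr B = r + r' + 1 by rewrite rDr' subrK.
    transitivity ((x - 1) * (x ^+ 2 - (r + r') * x + 1)); first by ring.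
    by rewrite -rr'; ring.
  exists u => //; apply/eqP; rewrite eq_sym -subr_eq0 -mul_scalar_mx -mulmxBl.
  by rewrite Bu.
have r1 : r != 1 by apply: r_neq; left.
have r'1 : r' != 1 by apply: contra_neq r1 => r'1; rewrite -rr' r'1 mulr1.
have rN : r * r != 1.
  by rewrite -expr2 sqrf_eq1 negb_or r1 r_neq //; right.
have r'N : r' * r' != 1.
  apply: contra_neq rN => r'N.
  by rewrite -[LHS]mulr1 -r'N mulrACA rr' mulr1.
have rr'N : r != r' by apply: contra_neq rN => rE; rewrite {2}rE.
have [|u0 u0n Bu0] := eigen 1; first by rewrite subrr mul0r.
have [|u1 u1n Bu1] := eigen r; first by rewrite subrr mul0r mulr0.
have [|v2 v2n Bv2] := eigen r'; first by rewrite subrr !mulr0.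
have orth Z W a b := @eigenvectors_orthogonal _ BU Z W a b.
have h01 : h u0 u1 = 0 by apply: (orth _ _ _ _ Bu0 Bu1); rewrite rC mul1r.
have h11 : h u1 u1 = 0 by apply: (orth _ _ _ _ Bu1 Bu1); rewrite rC.
have P1 : cols3 u0 u1 v2 \in unitmx.
  by apply: (eigenvectors_unit Bu0 Bu1 Bv2); rewrite // eq_sym.
(* Otherwise u1 would be orthogonal to the whole eigenbasis. *)
have h12 : h u1 v2 != 0.
  apply: contraNneq u1n => h12; apply/eqP/form_nondegenerate => W.
  have [a [b [c ->]]] := cols3_span W P1; rewrite !hformE.
  by rewrite (hformC H_herm u1 u0) h01 h11 h12 conjC0 !mulr0 !addr0.
pose u2 := (h u1 v2)^*^-1 *: v2.
have Bu2 : B *m u2 = r' *: u2.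
  by rewrite -scalemxAr Bv2 !scalerA mulrC.
have u2n : u2 != 0 by rewrite scaler_eq0 invr_eq0 conjC_eq0 negb_or h12.
have h02 : h u0 u2 = 0 by apply: (orth _ _ _ _ Bu0 Bu2); rewrite r'C mul1r.
have h22 : h u2 u2 = 0 by apply: (orth _ _ _ _ Bu2 Bu2); rewrite r'C.
have {}h12 : h u1 u2 = 1 by rewrite hformZr fmorphV /= conjCK mulVf.
have h21 : h u2 u1 = 1 by rewrite hformC // h12 conjC1.
have P2 : cols3 u0 u1 u2 \in unitmx.
  by apply: (eigenvectors_unit Bu0 Bu1 Bu2); rewrite // eq_sym.
have c1 := is_sign_conj s1; have c2 := is_sign_conj s2.
have c3 : (e1 / t)^* = e1 / t by rewrite rmorphM fmorphV /= tR c1.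
(* Both reflections exchange the lines of u1 and u2: the second one maps u1 to
   e2 u2, the first one maps u2 to e1 t^2 u1, and e1 e2 t^2 = r. *)
exists (t *: u1 + (e1 / t) *: u2), (u1 + e2 *: u2).
clearbody u2; have hE := (hformE, h01, h02, h11, h12, h21, h22, tR, c2, c3).
split.
- by rewrite !hE; field.
- by rewrite !hE; ring.
apply: (eq_on_basis P2); rewrite -mulmxA !refl_mul.
- by rewrite Bu0 !hE; apply/matrixP => i j; rewrite !mxE; ring.
- rewrite Bu1 !hE /r /e; apply/matrixP => i j; rewrite !mxE.
  by case: s1 => ->; case: s2 => ->; field.
- rewrite Bu2 !hE /r' /e; apply/matrixP => i j; rewrite !mxE.
  by case: s1 => ->; case: s2 => ->; field.
Qed.

End Signature.

(** * Choice of the scalar and of the third reflection *)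

Section Numbers.
Variable R : realType.
Local Notation C := R[i].

Lemma complex_eq (x y : C) :
  complex.Re x = complex.Re y -> complex.Im x = complex.Im y -> x = y.
Proof. by case: x y => a b [c d] /= -> ->. Qed.

(** One of the three cube roots of z lies in the open right half-plane, since
    they sum to 0 and are not all on the imaginary axis. *)
Lemma cube_root_Re_gt0 (z : C) :
  z != 0 -> exists2 w, w ^+ 3 = z & 0 < complex.Re w.
Proof.
move=> z0; have := rootCK (ltn0Sn 2) z; move: (3.-root z) => [a b] wz.
have ab0 : (a != 0) || (b != 0).
  rewrite -negb_and; apply: contra z0 => /andP[/eqP a0 /eqP b0].
  by rewrite -wz a0 b0 expf_eq0 /= eq_complex /= eqxx.
have [a_gt0|a_le0] := ltP 0 a; first by exists (a +i* b)%C.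
have s3 : Num.sqrt 3%:R ^+ 2 = 3%:R :> R by rewrite sqr_sqrtr ?ler0n.
have s3_gt0 : 0 < Num.sqrt 3%:R :> R by rewrite sqrtr_gt0 ltr0n.
set s := Num.sqrt 3%:R in s3 s3_gt0.
(* For c = 1 and c = -1, the two primitive cube roots of unity. *)
pose om (c : R) : C := ((- 1 / 2%:R) +i* (c * s / 2%:R))%C.
have omE c : c ^+ 2 = 1 -> om c ^+ 3 = 1.
  move=> c2; rewrite !exprS expr0 /om; apply: complex_eq => /=.
    transitivity (- 1 / 8%:R + 3%:R / 8%:R * (c ^+ 2 * s ^+ 2)); first by field.
    by rewrite c2 s3; field.
  transitivity (c * s / 8%:R * (3%:R - c ^+ 2 * s ^+ 2)); first by field.
  by rewrite c2 s3; field.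
have main c : c ^+ 2 = 1 -> 0 <= - c * b ->
    exists2 w, w ^+ 3 = z & 0 < complex.Re w.
  move=> c2 cb; exists (om c * (a +i* b)%C); first by rewrite exprMn omE ?mul1r.
  have sb : 0 <= s * (- c * b) by rewrite mulr_ge0 // ltW.
  have [a_lt0|a_ge0] := ltP a 0; first by rewrite /=; lra.
  have a0 : a = 0 by apply/eqP; rewrite eq_le a_le0.
  have : 0 < s * (- c * b).
    rewrite mulr_gt0 // lt0r cb mulf_neq0 ?oppr_eq0 //.
      by apply: contra_eq_neq c2 => ->; rewrite expr0n eq_sym oner_neq0.
    by move: ab0; rewrite a0 eqxx.
  by rewrite /= a0; lra.
have [b0|b0] := leP 0 b.
  by apply: (main (-1)); rewrite ?sqrrN ?expr1n // opprK mul1r.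
by apply: (main 1); rewrite ?expr1n // mulN1r oppr_ge0 ltW.
Qed.

(** The left-hand side of the last equation is the trace of g times the
    reflection of type e in n = x V1 + V2 + y V3, where g has eigenvalues w r,
    w / r and w^-2 = w^*^2 on V1, V2 and V3, and |y|^2 = 2e - x - x^*.  With
    x = e (1 + t) + i q, it equals w Y - (1 + 2t) w^*^2 where
    Y = (r + 1/r) t + i e q (r - 1/r), so it takes the value T exactly when
    Y = T w^* + (1 + 2t) w^*^3.  The real part of this equation determines t
    and the imaginary part determines q.  The inequality 0 <= |y|^2 becomes
    e t <= 0, which holds for large |T| when T has the sign tau and
    e tau Re w < 0. *)
Lemma trace_parameter (r e tau : R) (w : C) :
  0 < r -> r != 1 -> w * w^* = 1 -> is_sign e -> is_sign tau ->
  0 < - (e * tau * complex.Re w) ->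
  exists (x : C) (T : R),
  [/\ 4%:R <= tau * T, 0 <= 2%:R * e%:C%C - x - x^* &
   - (w * r%:C%C + (w^*) ^+ 2 + w / r%:C%C) +
   e%:C%C * (w * r%:C%C * x + (w^*) ^+ 2 * (2%:R * e%:C%C - x - x^*)
             + w / r%:C%C * x^*)
   = T%:C%C].
Proof.
case: w => a b r0 r1 /eqP; rewrite eq_complex /= => /andP[/eqP ab _] es ts a0.
have {}ab : a ^+ 2 + b ^+ 2 = 1 by rewrite -ab; ring.
(* The real and imaginary parts of w^3. *)
pose c := a ^+ 3 - 3%:R * a * b ^+ 2; pose d := 3%:R * a ^+ 2 * b - b ^+ 3.
have cd : c ^+ 2 + d ^+ 2 = 1.
  transitivity ((a ^+ 2 + b ^+ 2) ^+ 3); first by rewrite /c /d; ring.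
  by rewrite ab expr1n.
have c1 : -1 <= c <= 1 by nra.
have e2 : e ^+ 2 = 1 by case: es => ->; ring.
have t2 : tau ^+ 2 = 1 by case: ts => ->; ring.
have a_neq0 : a != 0 by apply: contraTneq a0 => ->; rewrite mulr0 oppr0 ltxx.
(* |T| = 4 + 1 / |a|, so that |T a| exceeds |c|, which is at most 1. *)
pose T := tau * 4%:R - e / a.
pose K := r + r^-1 - 2%:R * c.
have r_neq0 : r != 0 by rewrite gt_eqF.
have K0 : 0 < K.
  have -> : K = (r - 1) ^+ 2 / r + 2%:R * (1 - c) by rewrite /K; field.
  apply: ltr_pwDl; last by lra.
  by rewrite divr_gt0 // exprn_even_gt0 //= subr_eq0.
have rV : r - r^-1 != 0.
  have -> : r - r^-1 = (r - 1) * (r + 1) / r by field.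
  by rewrite !mulf_neq0 ?invr_eq0 ?subr_eq0 // gt_eqF // addr_gt0.
pose t := (T * a + c) / K.
pose q := e * (- T * b - (1 + 2%:R * t) * d) / (r - r^-1).
have et : 0 <= - e * t.
  have -> : - e * t = (4%:R * - (e * tau * a) + (e ^+ 2 - e * c)) / K.
    by rewrite /t /T; field; rewrite gt_eqF.
  rewrite divr_ge0 ?ltW // e2; case: es a0 => -> a0; by lra.
exists ((e * (1 + t)) +i* q)%C, T; split.
- have -> : tau * T = 4%:R * tau ^+ 2 + - (e * tau * a) / a ^+ 2.
    by rewrite /T; field.
  by rewrite t2 mulr1 lerDl divr_ge0 ?ltW // exprn_even_gt0.
- by rewrite lecE /=; apply/andP; split; [apply/eqP; ring | lra].
pose w : C := (a +i* b)%C.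
have w3 : (w^*) ^+ 3 = (c +i* (- d))%C.
  by rewrite !exprS expr0 /w /c /d; apply: complex_eq => /=; ring.
pose Y : C := ((r + r^-1) * t +i* (e * q * (r - r^-1)))%C.
have YE : Y = T%:C%C * w^* + (1 + 2%:R * t)%:C%C * (w^*) ^+ 3.
  rewrite w3; apply: complex_eq => /=.
    have : K * t = T * a + c by rewrite /t mulrC divfK // gt_eqF.
    by rewrite /K => Kt; lra.
  have -> : e * q * (r - r^-1) = e ^+ 2 * (- T * b - (1 + 2%:R * t) * d).
    by rewrite /q -[e * _ * _]mulrA divfK //; ring.
  by rewrite e2; ring.
rewrite -/w.
have ww : w * w^* = 1.
  by apply: complex_eq => /=; rewrite -?ab; ring.
transitivity (w * Y - (1 + 2%:R * t)%:C%C * (w^*) ^+ 2); last first.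
  rewrite YE.
  transitivity (w * w^* * T%:C%C
    + (1 + 2%:R * t)%:C%C * (w^*) ^+ 2 * (w * w^* - 1)).
    by ring.
  by rewrite ww; ring.
have -> : ((e * (1 + t)) +i* q)%C^* = e%:C%C * (1 + t%:C%C) - 'i%C * q%:C%C.
  by apply: complex_eq => /=; ring.
have -> : ((e * (1 + t)) +i* q)%C = e%:C%C * (1 + t%:C%C) + 'i%C * q%:C%C.
  by apply: complex_eq => /=; ring.
have -> : Y = (r%:C%C + r%:C%C^-1) * t%:C%C
    + 'i%C * e%:C%C * q%:C%C * (r%:C%C - r%:C%C^-1).
  by rewrite -fmorphV; apply: complex_eq => /=; ring.
rewrite (_ : (1 + 2%:R * t)%:C%C = 1 + 2%:R * t%:C%C); last first.
  by rewrite rmorphD rmorphM rmorph1 rmorph_nat.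
have rC : r%:C%C != 0 by rewrite fmorph_eq0.
have eC : e%:C%C = 1 \/ e%:C%C = -1.
  by case: es => ->; [left|right]; rewrite ?rmorphN rmorph1.
by case: eC => ->; field.
Qed.

End Numbers.

(** * Loxodromic elements *)

Section Loxodromic.
Variables (R : realType) (H : 'M[R[i]]_3).
Local Notation C := R[i].
Local Notation h := (hform H).
Implicit Types (Z W n : 'cV[C]_3) (a b c e : C) (M : 'M[C]_3).
Hypotheses (H_herm : H \is hermsymmx) (H_sign : signature21 H).

Lemma U21_act_line (g : U21 H) Z :
  U21_act g <[Z]>%VS = <[Z]>%VS <-> exists k, val g *m Z = k *: Z.
Proof.
rewrite /U21_act limg_line lfunE /=; split=> [gZ|[k gZ]].
  by apply/vlineP; rewrite -gZ memv_line.
have [->|Z0] := eqVneq Z 0; first by rewrite mulmx0.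
rewrite gZ; apply/eqP; rewrite eqEsubv -!memvE memvZ ?memv_line //=.
apply/vlineP; exists k^-1; rewrite scalerA mulVf ?scale1r //.
apply: contra_neq Z0 => k0; rewrite -[Z](mulKmx (U21_unit g)) gZ k0 scale0r.
by rewrite mulmx0.
Qed.

Lemma in_boundary_line (L : {vspace 'cV[C]_3}) : in_boundary_H2C H L ->
  exists Z, [/\ Z != 0, h Z Z = 0 & L = <[Z]>%VS].
Proof.
move=> [L1 L0]; have Z0 : vpick L != 0 by rewrite vpick0 -dimv_eq0 L1.
exists (vpick L); split=> //; first exact/L0/memv_pick.
by apply/esym/eqP; rewrite eqEdim -memvE memv_pick L1 dim_vline Z0.
Qed.

(** V is in the kernel of the 3 x 3 matrix whose rows are the linear forms
    <.,Z>, <.,W> and 0. *)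
Lemma orthogonal_vector Z W : exists2 V, V != 0 & h V Z = 0 /\ h V W = 0.
Proof.
pose P := cols3 Z W 0.
have P0 : \det P = 0 by rewrite det_mx33 !mxE /=; ring.
have [|V V0 PV] := @det0_ker _ _ (P^t* *m H).
  rewrite det_mulmx (_ : \det (P^t*) = 0) ?mul0r //.
  by rewrite det_map_mx det_tr P0 rmorph0.
have hV a b : h V (a *: Z + b *: W) = 0.
  have -> : a *: Z + b *: W = P *m col3 a b 0.
    by rewrite cols3_col3 scaler0 addr0.
  by rewrite /hform trmx_mul map_mxM -!mulmxA (mulmxA (P^t*)) PV mulmx0 mxE.
exists V => //; split.
  by have := hV 1 0; rewrite scale1r scale0r addr0.
by have := hV 0 1; rewrite scale1r scale0r add0r.
Qed.

Definition hyperbolic_basis V1 V2 V3 :=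
  [/\ h V1 V1 = 0, h V2 V2 = 0 & h V1 V2 = 1] /\
  [/\ h V3 V1 = 0, h V3 V2 = 0 & h V3 V3 = 1].

Lemma hyperbolic_basis_unit V1 V2 V3 :
  hyperbolic_basis V1 V2 V3 -> cols3 V1 V2 V3 \in unitmx.
Proof.
move=> [[h11 h22 h12] [h31 h32 h33]]; apply: cols3_unit => a b c abc.
have h21 : h V2 V1 = 1 by rewrite hformC // h12 conjC1.
have h13 : h V1 V3 = 0 by rewrite hformC // h31 conjC0.
have h23 : h V2 V3 = 0 by rewrite hformC // h32 conjC0.
have hE := (hformE, h11, h12, h13, h21, h22, h23, h31, h32, h33).
have hh Z : h (a *: V1 + b *: V2 + c *: V3) Z = 0.
  by rewrite abc -(scale0r (0 : 'cV_3)) hformZl mul0r.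
have := (hh V1, hh V2, hh V3); rewrite !hE !(mulr0, mulr1, addr0, add0r).
by move=> [[-> ->] ->].
Qed.

(** The two fixed boundary points give null eigenvectors V1 and V2, not
    orthogonal by the signature, and unitarity makes their eigenvalues l1, l2
    satisfy l1 l2^* = 1.  If l1 had modulus 1, then l1 = l2 and the negative
    vector V1 - V2 would span a fixed point inside the complex hyperbolic
    plane; so r = |l1| is not 1.  The orthogonal complement of V1 and V2 is an
    invariant positive line. *)
Lemma loxodromic_eigenbasis (A : PU21 H) : loxodromic A ->
  exists (g : U21 H) (V1 V2 V3 : 'cV[C]_3) (r u a : C),
  [/\ A = \pi_(PU21 H) g, [/\ 0 < r, r != 1, u * u^* = 1 & a * a^* = 1],
   [/\ val g *m V1 = (u * r) *: V1, val g *m V2 = (u / r) *: V2 &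
    val g *m V3 = a *: V3] &
   hyperbolic_basis V1 V2 V3].
Proof.
move=> [no_neg [L1 [L2 [L12 fix12]]]].
pose g := repr A; have Ag : A = \pi_(PU21 H) g by rewrite reprK.
have [L1b L1f] : in_boundary_H2C H L1 /\ PU21_act A L1 = L1.
  by apply/fix12; left.
have [L2b L2f] : in_boundary_H2C H L2 /\ PU21_act A L2 = L2.
  by apply/fix12; right.
have [V1 [V1n h11 E1]] := in_boundary_line L1b.
have [W2 [W2n k22 E2]] := in_boundary_line L2b.
have [l1 g1] : exists k, val g *m V1 = k *: V1.
  by apply/U21_act_line; rewrite -E1.
have [l2 k2] : exists k, val g *m W2 = k *: W2.
  by apply/U21_act_line; rewrite -E2.
have k12 : h V1 W2 != 0.
  apply/eqP => k12.
  have [||a aE] := orthogonal_nonpositive H_herm H_sign _ _ k12 V1n.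
  - by rewrite h11.
  - by rewrite k22.
  case: L12; rewrite E1 E2; apply/esym/eqP.
  rewrite eqEdim -memvE aE memvZ ?memv_line //=.
  by rewrite -aE !dim_vline V1n W2n.
pose V2 := (h V1 W2)^*^-1 *: W2.
have g2 : val g *m V2 = l2 *: V2 by rewrite -scalemxAr k2 !scalerA mulrC.
have h12 : h V1 V2 = 1 by rewrite hformZr fmorphV /= conjCK mulVf.
have h22 : h V2 V2 = 0 by rewrite hformZl hformZr k22 !mulr0.
have h21 : h V2 V1 = 1 by rewrite hformC // h12 conjC1.
clearbody V2.
have gU : Defs.is_unitary H (val g) by case: (g).
have ll : l1 * l2^* = 1.
  by have := hform_unitary V1 V2 gU; rewrite g1 g2 hformZl hformZr h12 mulr1.
have ll' : l2 * l1^* = 1.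
  by rewrite -[LHS]conjCK rmorphM /= conjCK mulrC ll conjC1.
have l10 : l1 != 0.
  by apply: contra_eq_neq ll => ->; rewrite mul0r eq_sym oner_neq0.
have l20 : l2 != 0.
  by apply: contra_eq_neq ll => ->; rewrite conjC0 mulr0 eq_sym oner_neq0.
pose N := V1 - V2.
have hNN : h N N = - 2%:R by rewrite !hformE h11 h22 h12 h21; ring.
have Nn : N != 0.
  apply/eqP => N0; move: hNN; rewrite N0 hform0r => /esym/eqP.
  by rewrite oppr_eq0 pnatr_eq0.
have N2 : h N N < 0 by rewrite hNN oppr_lt0 ltr0n.
have [W3 W3n [k31 k32]] := orthogonal_vector V1 V2.
have k33 : 0 < h W3 W3.
  rewrite real_ltNge ?hform_real ?real0 //; apply/negP => k33.
  have [|a aE] := orthogonal_nonpositive H_herm H_sign (ltW N2) k33 _ Nn.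
    by rewrite hformC // !hformE k31 k32 oppr0 addr0 conjC0.
  case/eqP: W3n; rewrite aE; move: k31; rewrite aE !hformE h11 h21 add0r mulrN1.
  by move=> /eqP; rewrite oppr_eq0 => /eqP ->; rewrite scale0r.
pose V3 := (sqrtC (h W3 W3))^-1 *: W3.
have h31 : h V3 V1 = 0 by rewrite hformZl k31 mulr0.
have h32 : h V3 V2 = 0 by rewrite hformZl k32 mulr0.
have h33 : h V3 V3 = 1.
  rewrite hformZl hformZr (@geC0_conj _ (sqrtC _)^-1); last first.
    by rewrite invr_ge0 sqrtC_ge0 ltW.
  by rewrite mulrA -expr2 exprVn sqrtCK mulVf // gt_eqF.
clearbody V3.
have P : cols3 V1 V2 V3 \in unitmx by exact: hyperbolic_basis_unit.
have [a g3] : exists a, val g *m V3 = a *: V3.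
  have [a [b [c gE]]] := cols3_span (val g *m V3) P; exists c.
  have : h (val g *m V3) V1 = 0.
    have := hform_unitary V3 V1 gU; rewrite h31 g1 hformZr => /eqP.
    by rewrite mulf_eq0 conjC_eq0 (negPf l10) => /eqP.
  have : h (val g *m V3) V2 = 0.
    have := hform_unitary V3 V2 gU; rewrite h32 g2 hformZr => /eqP.
    by rewrite mulf_eq0 conjC_eq0 (negPf l20) => /eqP.
  rewrite gE !hformE h11 h12 h21 h22 h31 h32 !(mulr0, mulr1, addr0, add0r).
  by move=> -> ->; rewrite !scale0r !add0r.
have aa : a * a^* = 1.
  by have := hform_unitary V3 V3 gU; rewrite g3 hformZl hformZr h33 mulr1.
have l1N : `|l1| != 1.
  apply/eqP => l1N; have l12 : l1 = l2.
    apply: (mulIf (_ : l1^* != 0)); first by rewrite conjC_eq0.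
    by rewrite -normCK l1N expr1n ll'.
  apply: (no_neg <[N]>%VS).
    split=> [|Z /vlineP[k ->]]; first by rewrite dim_vline Nn.
    rewrite scaler_eq0 negb_or Nn andbT => k0.
    rewrite hformZl hformZr mulrA -normCK nmulr_llt0 //.
    by rewrite exprn_gt0 // normr_gt0.
  apply/U21_act_line; exists l1.
  by rewrite mulmxBr g1 g2 -l12 scalerBr.
have l1P : 0 < `|l1| by rewrite normr_gt0.
have l1P0 : `|l1| != 0 by rewrite normr_eq0.
exists g, V1, V2, V3, `|l1|, (l1 / `|l1|), a; split=> //.
- split=> //; rewrite rmorphM fmorphV /= conj_normC mulrACA -normCK.
  by rewrite -invfM -expr2 mulfV // expf_eq0.
- split=> //; first by rewrite divfK.
  rewrite g2; congr (_ *: _).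
  rewrite -mulrA -invfM -expr2 normCK invfM mulVKf //.
  apply: (mulIf (_ : l1^* != 0)); first by rewrite conjC_eq0.
  by rewrite mulVf ?conjC_eq0 // ll'.
Qed.

Lemma U21_scale (g : U21 H) c : c * c^* = 1 ->
  exists2 g' : U21 H, val g' = c *: val g & \pi_(PU21 H) g' = \pi_(PU21 H) g.
Proof.
move=> cc; have c0 : c != 0.
  by apply: contra_eq_neq cc => ->; rewrite mul0r eq_sym oner_neq0.
have cg : Defs.is_unitary H (c *: val g).
  case: g => g /andP[gU /eqP gH] /=.
  rewrite /Defs.is_unitary /= unitmxZ ?unitfE // gU.
  rewrite [(c *: g)^T]linearZ /= map_mxZ.
  rewrite -!scalemxAl -scalemxAr scalerA gH.
  by rewrite [X in X *: _](_ : _ = 1) ?scale1r // -cc mulrC.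
exists (MkU21 cg) => //; apply/esym/eqP/piPU_eqP.
by exists c.
Qed.

(** Rescaling the lift by w u^* makes its determinant 1 as soon as w^3 is
    u a^*; the three cube roots leave the sign of Re w free. *)
Lemma loxodromic_lift (s : R) (A : PU21 H) : is_sign s -> loxodromic A ->
  exists (g : U21 H) (V1 V2 V3 : 'cV[C]_3) (r : R) (w : C),
  [/\ A = \pi_(PU21 H) g,
   [/\ 0 < r, r != 1, w * w^* = 1 & 0 < s * complex.Re w],
   [/\ val g *m V1 = (w * r%:C%C) *: V1, val g *m V2 = (w / r%:C%C) *: V2 &
    val g *m V3 = (w^* ^+ 2) *: V3] &
   hyperbolic_basis V1 V2 V3].
Proof.
move=> s_sign /loxodromic_eigenbasis[g [V1 [V2 [V3 [r [u [a []]]]]]]].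
move=> -> [r0 r1 uu aa] [g1 g2 g3] V123.
have nz z : z * z^* = 1 -> z != 0 :> C.
  by move=> zz; apply: contra_eq_neq zz => ->; rewrite mul0r eq_sym oner_neq0.
have s2 : s ^+ 2 = 1 by case: s_sign => ->; ring.
have sC : s%:C%C ^+ 2 = 1 by rewrite -rmorphXn /= s2 rmorph1.
have s0 : s%:C%C != 0 by rewrite -sqrf_eq0 sC oner_neq0.
have [|w' w'3 Rew'] := @cube_root_Re_gt0 R (s%:C%C * u * a^*).
  by rewrite !mulf_neq0 ?conjC_eq0 //; apply: nz.
pose w := s%:C%C * w'.
have w3 : w ^+ 3 = u * a^*.
  by rewrite /w exprMn w'3 !mulrA -exprSr (exprM _ 2 2) sC expr1n mul1r.
have ww : w * w^* = 1.
  have : (w * w^*) ^+ 3 = 1.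
    by rewrite exprMn -rmorphXn /= w3 rmorphM /= conjCK mulrACA uu mul1r mulrC.
  by rewrite -normCK => /eqP; rewrite pexpr_eq1 ?exprn_ge0 // => /eqP.
have [|g' g'E g'A] := U21_scale g (c := w * u^*).
  by rewrite rmorphM /= conjCK mulrACA ww mul1r mulrC.
have [rr rE] : exists rr : R, r = rr%:C%C.
  by exists (complex.Re r); rewrite RRe_real // gtr0_real.
exists g', V1, V2, V3, rr, w; rewrite -rE; split=> //.
- split=> //; first by move: r0; rewrite rE ltcR.
    by move: r1; rewrite rE; apply: contra_neq => ->.
  rewrite /w; case: w' Rew' {w'3 w w3 ww g'E} => x y /= x0.
  by rewrite mul0r subr0 mulrA -expr2 s2 mul1r.
- rewrite g'E -!scalemxAl g1 g2 g3 !scalerA.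
  split; congr (_ *: _).
  + by rewrite -mulrA (mulrA _ u) (mulrC _ u) uu mul1r.
  + by rewrite -mulrA (mulrA _ u) (mulrC _ u) uu mul1r.
  + have uE : u^* * a = w^* ^+ 3 by rewrite -rmorphXn /= w3 rmorphM /= conjCK.
    by rewrite -mulrA uE exprS mulrA ww mul1r.
Qed.

Lemma U21_refl_kind (k : int) n (s : is_sign (k%:~R : C))
    (hn : h n n = k%:~R * 2%:R) :
  (k = 1 -> complex_symmetry (\pi_(PU21 H) (U21_refl H_herm s hn))) /\
  (k = -1 -> central_involution (\pi_(PU21 H) (U21_refl H_herm s hn))).
Proof.
split=> k1; exists n.
- by rewrite hn k1 mul1r.
- by eexists; first reflexivity; move=> Z /=; rewrite refl_mul k1 mul1r.
- by rewrite hn k1 mulrN1z mulN1r.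
- eexists; first reflexivity; move=> Z /=.
  by rewrite refl_mul k1 mulrN1z mulN1r scaleNr.
Qed.

(** The lift with - e tau Re w > 0 is the one for which the trace can be made
    large with the sign tau. *)
Lemma loxodromic_times_reflection (A : PU21 H) (e tau : R) :
  is_sign e -> is_sign tau -> loxodromic A ->
  exists (g : U21 H) n, [/\ A = \pi_(PU21 H) g, \det (val g) = 1,
    h n n = e%:C%C * 2%:R & 4%:R <= tau%:C%C * \tr (val g *m refl H e%:C%C n)].
Proof.
move=> es ts A_lox.
have [|g [V1 [V2 [V3 [r [w []]]]]]] := @loxodromic_lift (- (e * tau)) A _ A_lox.
  by case: (is_signM es ts) => ->; [right|left]; rewrite ?opprK.
move=> -> [r0 r1 ww Rew] [g1 g2 g3] V123.
have [[h11 h22 h12] [h31 h32 h33]] := V123.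
have [|x [T [T4 y0 trE]]] := trace_parameter r0 r1 ww es ts _.
  by rewrite -mulNr.
have h21 : h V2 V1 = 1 by rewrite hformC // h12 conjC1.
have h13 : h V1 V3 = 0 by rewrite hformC // h31 conjC0.
have h23 : h V2 V3 = 0 by rewrite hformC // h32 conjC0.
pose y := sqrtC (2%:R * e%:C%C - x - x^*).
have yy : y * y^* = 2%:R * e%:C%C - x - x^*.
  by rewrite geC0_conj ?sqrtC_ge0 // -expr2 sqrtCK.
have P : cols3 V1 V2 V3 \in unitmx by exact: hyperbolic_basis_unit.
have [trg detg] := eigenbasis_tr_det P g1 g2 g3.
have rC : r%:C%C != 0 by rewrite fmorph_eq0 gt_eqF.
exists g, (x *: V1 + V2 + y *: V3).
have hE := (hformE, h11, h12, h13, h21, h22, h23, h31, h32, h33).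
split=> //.
- rewrite detg; transitivity ((w * w^*) ^+ 2); first by field.
  by rewrite ww expr1n.
- rewrite !hE; transitivity (x + x^* + y * y^*); first by ring.
  by rewrite yy; ring.
rewrite refl_trace // trg !mulmxDr -!scalemxAr g1 g2 g3 !hE.
rewrite [X in _ * X](_ : _ = T%:C%C).
  by move: T4; rewrite -lecR rmorphM /= rmorph_nat.
by rewrite -trE -yy; ring.
Qed.

End Loxodromic.

Theorem proposition9 (R : realType) (H : 'M[R[i]]_3)
    (H_herm : H \is hermsymmx) (H_sign : signature21 H)
    (A : PU21 H) (A_lox : loxodromic A)
    (e1 e2 e3 : int)
    (e1_sign : e1 = -1 \/ e1 = 1) (e2_sign : e2 = -1 \/ e2 = 1)
    (e3_sign : e3 = -1 \/ e3 = 1) :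
  exists I1 I2 I3 : PU21 H,
    [/\ involution I1, involution I2 & involution I3] /\
    A = (I1 * I2 * I3)%g /\
    [/\ (e1 = 1 -> complex_symmetry I1) /\ (e1 = -1 -> central_involution I1),
        (e2 = 1 -> complex_symmetry I2) /\ (e2 = -1 -> central_involution I2) &
        (e3 = 1 -> complex_symmetry I3) /\ (e3 = -1 -> central_involution I3)].
Proof.
have s1 : is_sign (e1%:~R : R[i]) by exact: is_sign_intr.
have s2 : is_sign (e2%:~R : R[i]) by exact: is_sign_intr.
have s3 : is_sign (e3%:~R : R[i]) by exact: is_sign_intr.
have [||g [n3 [gA detg n3n trB]]] := loxodromic_times_reflection H_herm H_sign
  (e := e3%:~R) (tau := (e1 * e2)%:~R) _ _ A_lox.
- exact: is_sign_intr.
- by apply: is_sign_intr; case: e1_sign => ->; case: e2_sign => ->; auto.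
rewrite !(rmorph_int (real_complex R)) /= rmorphM /= in n3n trB.
have [||n1 [n2 [n1n n2n B]]] :=
  two_reflections_of_trace H_herm H_sign s1 s2 _ _ trB.
- exact: (valP (g * U21_refl H_herm s3 n3n)%g).
- by rewrite det_mulmx detg refl_det // mulr1.
exists (\pi_(PU21 H) (U21_refl H_herm s1 n1n)).
exists (\pi_(PU21 H) (U21_refl H_herm s2 n2n)).
exists (\pi_(PU21 H) (U21_refl H_herm s3 n3n)).
split; first by split; exact: refl_involution.
split; last by split; exact: U21_refl_kind.
have piM (g1 g2 : U21 H) :
    (\pi_(PU21 H) g1 * \pi_(PU21 H) g2)%g = \pi_(PU21 H) (g1 * g2)%g.
  exact: PU21_mul_pi.
rewrite gA !piM; congr (\pi_(PU21 H) _); apply: val_inj => /=.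
by rewrite -B -mulmxA refl_refl // mulmx1.
Qed.
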